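(* Let $\mathcal{A}$ be a non-degenerate ergodic Markovian automaton on $\tilde A$, without a cycle of probability $1$, with support consisting of reduced words, and with coincidence probability $\alpha_{[2]}$. Let $\lambda\in(0,\frac12)$ and $d\in(\frac\lambda2,1)$. A tuple of cyclically reduced words of length $n$ taken independently and randomly according to $\mathcal{A}$, at $\alpha_{[2]}$-density $d$ (that is, a tuple of $\alpha_{[2]}^{-dn}$ words), generically (as $n\to\infty$) does not satisfy the small cancellation property $C'(\lambda)$.
   Context: $A$ is a finite non-empty alphabet, $\tilde A=A\sqcup A^{-1}$. A word over $\tilde A$ is reduced if it has no factor $aa^{-1}$ ($a\in\tilde A$), and cyclically reduced if it is non-empty, reduced and its first and last letters are not mutually inverse. $\mathcal{C}_n$ is the set of cyclically reduced words of length $n$. A Markovian automaton $\mathcal{A}$ on $\tilde A$ consists of: a deterministic transition system $(Q,\cdot)$ with $Q$ a finite non-empty set of states and, for each $q\in Q$, $a\in\tilde A$, either $q\cdot a\in Q$ or $q\cdot a$ undefined; an initial probability vector $\gamma_0\in[0,1]^Q$, $\sum_q\gamma_0(q)=1$; and for each $p\in Q$ a probability vector $(\gamma(p,a))_{a\in\tilde A}$ with $\gamma(p,a)=0$ if and only if $p\cdot a$ is undefined. For a word $u=x_0\cdots x_n$, $\gamma(q,u)=\gamma(q,x_0)\gamma(q\cdot x_0,x_1)\cdots\gamma(q\cdot(x_0\cdots x_{n-1}),x_n)$, and $\gamma_0(u)=\sum_{q}\gamma_0(q)\gamma(q,u)$. The measure $\mathbb{R}_n$ on words of length $n$ is $\mathbb{R}_n(u)=\gamma_0(u)$;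 it is assumed that all words $u$ with $\gamma_0(u)\ne0$ are reduced. A cyclically reduced word of length $n$ is taken randomly according to $\mathcal{A}$ if it has law $\mathbb{R}_n(\cdot\mid\mathcal{C}_n)$ (defined for $n$ large enough). A cycle of probability $1$ is a state $q$ and a non-empty word $u$ with $q\cdot u=q$ and $\gamma(q,u)=1$. Let $M(p,q)=\sum_{a:\,p\cdot a=q}\gamma(p,a)$. $\mathcal{A}$ is ergodic if its transition graph is strongly connected and, for all large enough $n$, $M^n(q,q)>0$ for each $q$; its stationary vector $\tilde\gamma$ is the unique probability vector with $\tilde\gamma M=\tilde\gamma$. For $a\in\tilde A$ write $\gamma_0(a)=\sum_q\gamma_0(q)\gamma(q,a)$ and $\tilde\gamma(a)=\sum_q\tilde\gamma(q)\gamma(q,a)$. $\mathcal{A}$ is non-degenerate if $\sum_{a\in\tilde A}\gamma_0(a)\tilde\gamma(a^{-1})\ne1$. Coincidence probability: let $Q'=\{(q,a)\in Q\times\tilde A:\exists p\in Q,\ p\cdot a=q\}$ and let $\mathbb{M}$ be the $Q'\times Q'$ matrix with $\mathbb{M}((p,a),(q,b))=\gamma(p,b)$ if $p\cdot b=q$ and $0$ otherwise. Let $\mathbb{M}_{[2]}$ be obtained by squaring each entry. Then $\alpha_{[2]}$ is the largest eigenvalue (spectral radius) of $\mathbb{M}_{[2]}$. For a tuple $\vec h=(h_1,\dots,h_k)$ of cyclically reduced words, $\vec h^\pm=(h_1,h_1^{-1},\dots,h_k,h_k^{-1})$; a piece is a word $u$ with at least two occurrences as a prefix of a cyclic conjugate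 of an entry of $\vec h^\pm$ (an occurrence is given by an index in $\vec h^\pm$ and a cyclic starting position). $\vec h$ satisfies $C'(\lambda)$ if whenever a piece $u$ occurs as a prefix of a cyclic conjugate $w$ of an entry of $\vec h^\pm$, then $|u|<\lambda|w|$. A property holds generically if its probability tends to $1$ as $n\to\infty$. Non-integer sizes are understood as their integer parts. *)

(* Defs.v *)
From HB Require Import structures.
From mathcomp Require Import all_boot all_order all_algebra.
From mathcomp Require Import complex.
From mathcomp Require Import all_classical all_reals all_analysis.
Set Implicit Arguments.
Unset Strict Implicit.
Unset Printing Implicit Defensive.
Import Order.TTheory GRing.Theory Num.Theory.
Import numFieldNormedType.Exports.
Local Open Scope classical_set_scope.
Local Open Scope ring_scope.

Definition letter (A : finType) : finType := (A + A)%type.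

Definition linv (A : finType) (x : letter A) : letter A :=
  match x with inl a => inr a | inr a => inl a end.

Definition winv (A : finType) (w : seq (letter A)) : seq (letter A) :=
  rev (map (@linv A) w).

Definition reduced (A : finType) (w : seq (letter A)) : bool :=
  [forall a : letter A, ~~ infix [:: a; linv a] w].

Definition cyc_reduced (A : finType) (w : seq (letter A)) : bool :=
  if w is x :: s then reduced w && (last x s != linv x) else false.

Definition prob_vector (R : realType) (T : finType) (f : T -> R) : Prop :=
  (forall x, 0 <= f x) /\ \sum_x f x = 1.

Record markov_automaton (R : realType) (A : finType) := MarkovAutomaton {
  state : finType;
  state_nonempty : (0 < #|state|)%N;
  trans : state -> letter A -> option state;
  init : state -> R;
  init_prob : prob_vector init;
  gam : state -> letter A -> R;
  gam_prob : forall p, prob_vector (gam p);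
  gam_eq0 : forall p a, gam p a = 0 <-> trans p a = None
}.

Section Automaton.
Variables (R : realType) (A : finType) (X : markov_automaton R A).

Fixpoint run (q : state X) (u : seq (letter A)) : option (state X) :=
  if u is a :: v then obind (fun q' => run q' v) (trans q a) else Some q.

(* The value 0 in the undefined case is forced by gam_eq0. *)
Fixpoint gam_word (q : state X) (u : seq (letter A)) : R :=
  if u is a :: v then
    if trans q a is Some q' then gam q a * gam_word q' v else 0
  else 1.

Definition init_word (u : seq (letter A)) : R :=
  \sum_(q : state X) init q * gam_word q u.

Definition has_prob1_cycle : Prop :=
  exists (q : state X) (u : seq (letter A)),
    [/\ u <> [::], run q u = Some q & gam_word q u = 1].

(* Matrices indexed by a finite type, through its canonical enumeration. *)
Definition fin_mx (T : finType) (F : T -> T -> R) : 'M[R]_#|T| :=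
  \matrix_(i, j) F (enum_val i) (enum_val j).

Definition step (p q : state X) : R := \sum_(a | trans p a == Some q) gam p a.

Definition edge (p q : state X) : bool := [exists a, trans p a == Some q].

Definition ergodic : Prop :=
  (forall p q, connect edge p q) /\
  \forall n \near \oo,
    forall q, 0 < (fin_mx step ^+ n) (enum_rank q) (enum_rank q).

Definition stationary (v : state X -> R) : Prop :=
  prob_vector v /\ forall q, \sum_p v p * step p q = v q.

Definition letter_prob (v : state X -> R) (a : letter A) : R :=
  \sum_q v q * gam q a.

(* v stands for the stationary vector. *)
Definition non_degenerate (v : state X -> R) : Prop :=
  \sum_(a : letter A) letter_prob (@init _ _ X) a * letter_prob v (linv a) <> 1.

Definition lstate : finType :=
  {qa : state X * letter A | [exists p, trans p qa.2 == Some qa.1]}.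

Definition lstep (x y : lstate) : R :=
  if trans (val x).1 (val y).2 == Some (val y).1 then gam (val x).1 (val y).2
  else 0.

(* The largest modulus of a complex eigenvalue. *)
Definition spectral_radius (n : nat) (B : 'M[R]_n) : R :=
  sup [set r : R | exists2 z : complex R,
    eigenvalue (map_mx (real_complex R) B) z & `|z| = real_complex R r].

Definition coincidence_prob : R :=
  spectral_radius (fin_mx (fun x y => lstep x y ^+ 2)).

Definition cyc_reduced_mass (n : nat) : R :=
  \sum_(v : n.-tuple (letter A) | cyc_reduced v) init_word v.

(* By the convention x / 0 = 0, this is identically 0 for the n at which the
   conditional law is undefined. *)
Definition cond_law (n : nat) (u : n.-tuple (letter A)) : R :=
  if cyc_reduced u then init_word u / cyc_reduced_mass n else 0.

(* Probability of E for N independent words drawn from cond_law n. *)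
Definition tuple_prob (n N : nat) (E : set (seq (seq (letter A)))) : R :=
  \sum_(h : N.-tuple (n.-tuple (letter A)) | `[< E (map val h) >])
    \prod_(i < N) cond_law (tnth h i).

Definition density_size (d : R) (n : nat) : nat :=
  Num.truncn (coincidence_prob `^ (- (d * n%:R))).

End Automaton.

Definition sym_tuple (A : finType) (h : seq (seq (letter A))) :
    seq (seq (letter A)) :=
  flatten [seq [:: w; winv w] | w <- h].

(* ij = (index in the symmetrized tuple, cyclic starting position). *)
Definition occurs_at (A : finType) (h : seq (seq (letter A)))
    (u : seq (letter A)) (ij : nat * nat) : Prop :=
  let w := nth [::] (sym_tuple h) ij.1 in
  [/\ (ij.1 < size (sym_tuple h))%N, (ij.2 < size w)%N
    & prefix u (rot ij.2 w)].

Definition piece (A : finType) (h : seq (seq (letter A)))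
    (u : seq (letter A)) : Prop :=
  exists ij kl, [/\ ij <> kl, occurs_at h u ij & occurs_at h u kl].

Definition small_cancellation (R : realType) (A : finType) (lambda : R)
    (h : seq (seq (letter A))) : Prop :=
  forall u ij, piece h u -> occurs_at h u ij ->
    (size u)%:R < lambda * (size (nth [::] (sym_tuple h) ij.1))%:R.

(* Main.v *)
(* Two words of the tuple sharing a prefix of length at least lambda n violate
   C'(lambda), so it suffices to find a collision among the N prefixes of length
   m ~ lambda n. By a birthday argument these are distinct with probability at
   most of order 1 / (N sqrt S), where S is the probability that two independent
   prefixes coincide. Non-degeneracy yields a letter a that can start a word and
   whose inverse is not forced in some state; by primitivity, words starting
   with a are cyclically reduced with conditional probability bounded below
   given their prefix, so S is at least a constant times the sum of the squared
   probabilities of the words of length m - 1 read from a fixed state.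
   Testing that sum against an eigenvector, and using irreducibility, bounds it
   below by a constant times alpha^m. As N ~ alpha^(- d n) and d > lambda / 2,
   N sqrt S grows exponentially. *)
Require Import Defs.
From mathcomp Require Import all_boot all_order all_algebra complex.
From mathcomp Require Import all_classical all_reals all_analysis.
From mathcomp Require Import ring lra zify.
Set Implicit Arguments.
Unset Strict Implicit.
Unset Printing Implicit Defensive.
Import Order.TTheory GRing.Theory Num.Theory.
Import numFieldNormedType.Exports.
Local Open Scope classical_set_scope.
Local Open Scope ring_scope.

(** * The birthday argument *)

Lemma big_tuple0 (R : realType) (T : finType) (P : pred (seq T))
    (F : seq T -> R) :
  \sum_(u : 0.-tuple T | P u) F u = if P [::] then F [::] else 0.
Proof.
rewrite big_mkcond (bigD1 [tuple]) //= big1 ?addr0 // => u /eqP[].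
exact: tuple0.
Qed.

Lemma big_cat_tuple (R : realType) (T : finType) (m k : nat)
    (P : pred (seq T)) (F : seq T -> R) :
  \sum_(v : (m + k).-tuple T | P v) F v =
  \sum_(u : m.-tuple T) \sum_(w : k.-tuple T | P (u ++ w)) F (u ++ w).
Proof.
rewrite pair_big_dep /=.
have takeP (v : (m + k).-tuple T) : size (take m v) == m.
  by rewrite size_takel // size_tuple leq_addr.
have dropP (v : (m + k).-tuple T) : size (drop m v) == k.
  by rewrite size_drop size_tuple addKn.
rewrite (reindex (fun p : m.-tuple T * k.-tuple T => cat_tuple p.1 p.2)) //=.
exists (fun v => (Tuple (takeP v), Tuple (dropP v))) => [[u w] _|v _].
  congr (_, _); apply: val_inj => /=.
    by rewrite take_size_cat ?size_tuple.
  by rewrite drop_size_cat ?size_tuple.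
by apply: val_inj; rewrite /= cat_take_drop.
Qed.

Lemma big_cons_tuple (R : realType) (T : finType) (k : nat)
    (P : pred (seq T)) (F : seq T -> R) :
  \sum_(v : k.+1.-tuple T | P v) F v =
  \sum_(a : T) \sum_(w : k.-tuple T | P (a :: w)) F (a :: w).
Proof.
rewrite (big_cat_tuple 1) (reindex (fun a : T => [tuple a])) //=.
exists (fun u : 1.-tuple T => thead u) => [//|u _].
by apply: val_inj; case/tupleP: u => a u; rewrite (tuple0 u).
Qed.

Lemma sum_prod_tuple (R : realType) (T : finType) (k : nat) (g : T -> R)
    (P : pred T) :
  \sum_(h : k.-tuple T | all P h) \prod_(x <- h) g x = (\sum_(x | P x) g x) ^+ k.
Proof.
elim: k => [|k IHk].
  by rewrite (big_tuple0 (all P) (fun h => \prod_(x <- h) g x)) /= big_nil.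
rewrite (big_cons_tuple _ (all P) (fun h => \prod_(x <- h) g x)) exprS.
rewrite -IHk big_distrl [RHS]big_mkcond /=; apply: eq_bigr => a _.
case: ifP => Pa /=; last by rewrite big_pred0.
by rewrite big_distrr /=; apply: eq_bigr => h _; rewrite big_cons.
Qed.

(** For a law [c], this is the probability that a fresh sample collides with [t]; its mean over [t]
    is the collision probability of two independent samples. *)
Definition class_mass (R : realType) (T : finType) (U : eqType) (c : T -> R)
  (f : T -> U) (t : T) : R := \sum_(x | f x == f t) c x.

(** Distinct images make the classes of the entries of [h] disjoint, so their masses add up. *)
Lemma sum_mem_map_uniq (R : realType) (T : finType) (U : eqType) (c : T -> R)
    (f : T -> U) (h : seq T) : uniq (map f h) ->
  \sum_(x | f x \in map f h) c x = \sum_(t <- h) class_mass c f t.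
Proof.
elim: h => [|t h IHh] /=; first by rewrite big_nil big_pred0.
case/andP => ft uh; rewrite big_cons -IHh // (bigID (fun x => f x == f t)) /=.
congr (_ + _); apply: eq_bigl => x; rewrite inE.
  by case: (f x == f t) => //=; rewrite andbF.
by case: eqP => [->|_] /=; rewrite ?andbT // (negPf ft).
Qed.

(* The second half of the sample has to avoid the classes hit by the first
   half; conditionally on the first half this has probability at most
   exp (- K' * their mass), which is a product over the first half. *)
Lemma injective_sample_le (R : realType) (T : finType) (U : eqType)
    (c : T -> R) (f : T -> U) (K K' : nat) :
  prob_vector c ->
  \sum_(h : (K + K').-tuple T | uniq (map f h)) \prod_(x <- h) c x <=
  (\sum_t c t * expR (- (K'%:R * class_mass c f t))) ^+ K.
Proof.
move=> [c_ge0 c_sum1].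
rewrite (big_cat_tuple _ _ (fun h => uniq (map f h))
  (fun h => \prod_(x <- h) c x)).
rewrite -(sum_prod_tuple _ _ predT) [leRHS](eq_bigl xpredT); last first.
  by move=> h; rewrite all_predT.
apply: ler_sum => h1 _.
have prod_ge0 (h : seq T) : 0 <= \prod_(x <- h) c x by apply: prodr_ge0.
have [uh|nuh] := boolP (uniq (map f h1)); last first.
  rewrite [leLHS]big_pred0 => [|h2]; last first.
    by rewrite map_cat cat_uniq (negPf nuh).
  by apply: prodr_ge0 => x _; rewrite mulr_ge0 // expR_ge0.
rewrite big_split /=.
apply: (@le_trans _ _ (\prod_(x <- h1) c x *
    (\sum_(x | f x \notin map f h1) c x) ^+ K')).
  rewrite -sum_prod_tuple big_distrr /= [leRHS]big_mkcond [leLHS]big_mkcond /=.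
  apply: ler_sum => h2 _; rewrite /= map_cat cat_uniq uh /= big_cat /=.
  have -> : has (in_mem^~ (mem (map f h1))) (map f h2) =
      ~~ all (fun x => f x \notin map f h1) h2.
    by rewrite has_map -has_predC; apply: eq_has => x /=; rewrite negbK.
  rewrite negbK; case: all => //=.
  by case: ifP => // _; rewrite mulr_ge0.
rewrite ler_wpM2l //.
have sum_avoid : \sum_(x | f x \notin map f h1) c x =
    1 - \sum_(t <- h1) class_mass c f t.
  rewrite -sum_mem_map_uniq // -c_sum1.
  by rewrite [X in X - _](bigID (fun x => f x \in map f h1)) /= addrAC subrr add0r.
rewrite -expR_sum sumrN -big_distrr /= -mulrN expRM_natl.
apply: lerXn2r; rewrite ?nnegrE ?expR_ge0 ?sumr_ge0 //.
by rewrite sum_avoid expR_ge1Dx.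
Qed.

(* [exp (- x) <= 1 / (1 + x)] reduces the claim to bounding the mean of
   [y q / (s + y q)] below by [s y / (1 + y)], where [y = K s] and [q] is the
   mass of the class of a sample: pointwise if no class has mass more than [s],
   and from the heavy class alone otherwise. *)
Lemma uniq_sample_le (R : realType) (T : finType) (U : eqType)
    (c : T -> R) (f : T -> U) (N : nat) (s : R) :
  prob_vector c -> 0 < s -> s ^+ 2 <= \sum_t c t * class_mass c f t ->
  (1 < N)%N ->
  \sum_(h : N.-tuple T | uniq (map f h)) \prod_(x <- h) c x <=
  (N./2%:R * s)^-1.
Proof.
move=> c_prob s_gt0 s_le N_gt1; set K := N./2.
have [c_ge0 c_sum1] := c_prob.
have K_gt0 : (0 < K)%N by rewrite half_gt0.
have K_gt0R : 0 < K%:R :> R by rewrite ltr0n.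
pose q := class_mass c f.
have q_ge0 t : 0 <= q t by apply: sumr_ge0.
pose y := K%:R * s.
have y_gt0 : 0 < y by rewrite mulr_gt0.
have le_KK' : (K <= N - K)%N.
  by rewrite leq_subRL /K; have := odd_double_half N; lia.
have expRN_le (x : R) : 0 <= x -> expR (- x) <= 1 - x / (1 + x).
  move=> x_ge0; have -> : 1 - x / (1 + x) = (1 + x)^-1 by field; lra.
  by rewrite expRN lef_pV2 ?posrE ?expR_gt0 ?expR_ge1Dx //; lra.
pose g (x : R) := x / (1 + x).
have g_homo (x x' : R) : 0 <= x -> x <= x' -> g x <= g x'.
  move=> x_ge0 le_xx'; rewrite /g ler_pdivrMr; last lra.
  rewrite mulrAC ler_pdivlMr; nra.
have g_ge0 x : 0 <= x -> 0 <= g x by move=> x_ge0; rewrite divr_ge0 //; lra.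
have mean_ge : s * g y <= \sum_t c t * g (K%:R * q t).
  have [/forallP q_le|/forallPn[t0]] := boolP [forall t, q t <= s].
    apply: (@le_trans _ _ (K%:R / (1 + y) * \sum_t c t * q t)).
      apply: (@le_trans _ _ (K%:R / (1 + y) * s ^+ 2)).
        by rewrite /g /y le_eqVlt; apply/orP; left; apply/eqP; field;
          rewrite -/y; lra.
      by rewrite ler_wpM2l // divr_ge0 //; lra.
    rewrite big_distrr /=; apply: ler_sum => t _.
    rewrite mulrCA ler_wpM2l // /g mulrAC ler_wpM2l ?mulr_ge0 //.
    have Kq_ge0 : 0 <= K%:R * q t by rewrite mulr_ge0.
    rewrite lef_pV2 ?posrE; [|lra|lra].
    by rewrite lerD2l ler_wpM2l // q_le.
  rewrite -ltNge => lt_sq.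
  apply: (@le_trans _ _ (q t0 * g (K%:R * q t0))).
    by rewrite ler_pM ?g_ge0 ?g_homo ?ltW // ltr_pM2l.
  rewrite /q {1}/class_mass big_distrl /= [leLHS]big_mkcond; apply: ler_sum => t _.
  rewrite -/q; case: eqP => [ft|_]; last by rewrite mulr_ge0 ?g_ge0 ?mulr_ge0.
  by rewrite /q /class_mass -ft.
have -> : N = (K + (N - K))%N by lia.
apply: (le_trans (injective_sample_le _ _ _ c_prob)).
apply: (@le_trans _ _ (expR (- (s * g y)) ^+ K)).
  apply: lerXn2r; rewrite ?nnegrE ?expR_ge0 //.
    by apply: sumr_ge0 => t _; rewrite mulr_ge0 ?expR_ge0.
  apply: le_trans (expR_ge1Dx _).
  apply: (@le_trans _ _ (\sum_t c t * (1 - g (K%:R * q t)))).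
    apply: ler_sum => t _; rewrite ler_wpM2l //.
    apply: le_trans (expRN_le _ _); last by rewrite mulr_ge0.
    by rewrite ler_expR lerN2 ler_wpM2r // ler_nat.
  under eq_bigr do rewrite mulrBr mulr1.
  by rewrite sumrB c_sum1 lerD2l lerN2.
rewrite -expRM_natl mulrN mulrA -/y.
apply: (le_trans (expRN_le _ _)); first by rewrite mulr_ge0 ?g_ge0 ?ltW.
have yg_ge0 : 0 <= y * g y by rewrite mulr_ge0 ?g_ge0 ?ltW.
have -> : 1 - y * g y / (1 + y * g y) = (1 + y * g y)^-1 by field; lra.
rewrite lef_pV2 ?posrE //; last lra.
(* Thus [1 + y * g y] is [y + 1 / (1 + y)], which exceeds [y = K * s]. *)
have -> : y * g y = y - 1 + (1 + y)^-1 by rewrite /g; field; lra.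
have : 0 < (1 + y)^-1 by rewrite invr_gt0; lra.
by move=> ?; lra.
Qed.

(** * Spectral radius of a nonnegative matrix *)

Lemma expmx_ge0 (R : realType) (n : nat) (B : 'M[R]_n) (k : nat) :
  (forall i j, 0 <= B i j) -> forall i j, 0 <= (B ^+ k) i j.
Proof.
move=> B_ge0; elim: k => [|k IHk] i j; first by rewrite expr0 mxE; case: eqP.
by rewrite exprS mxE; apply: sumr_ge0 => l _; rewrite mulr_ge0.
Qed.

(** A left eigenvector [v] satisfies [|z|^k |v_j| <= sum_i |v_i| (B^k)_ij]. Summing over [j] brings
    in the row sums of [B^k], and the [l^1] norm of [v] cancels. *)
Lemma eigenvalue_norm_le (R : realType) (n : nat) (B : 'M[R]_n) (k : nat)
    (M : R) (z : complex R) :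
  (forall i j, 0 <= B i j) ->
  (forall i, (B ^+ k *m const_mx 1 : 'cV_n) i 0 <= M) ->
  eigenvalue (map_mx (real_complex R) B) z -> `|z| ^+ k <= real_complex R M.
Proof.
move=> B_ge0 row_le /eigenvalueP[v v_eig v_neq0].
have Bk_ge0 := expmx_ge0 k B_ge0.
have vk_eig : v *m map_mx (real_complex R) (B ^+ k) = z ^+ k *: v.
  elim: k {row_le Bk_ge0} => [|k IHk].
    by rewrite !expr0 scale1r [map_mx _ _]rmorph1 mulmx1.
  by rewrite !exprS map_mxM mulmxA v_eig -scalemxAl IHk scalerA.
pose S := \sum_j `|v 0 j|.
have S_gt0 : 0 < S.
  rewrite lt_def sumr_ge0 // andbT; apply: contra v_neq0 => /eqP S0.
  apply/eqP/rowP => j; rewrite mxE; apply/eqP; rewrite -normr_eq0; apply/eqP.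
  by move: j (erefl true); apply/psumr_eq0P.
rewrite -(ler_pM2r S_gt0) {1}/S big_distrr /=.
apply: (@le_trans _ _ (\sum_j \sum_i `|v 0 i| * real_complex R ((B ^+ k) i j))).
  apply: ler_sum => j _; rewrite -normrX -normrM.
  have -> : z ^+ k * v 0 j = (z ^+ k *: v) 0 j by rewrite mxE.
  rewrite -vk_eig mxE; apply: (le_trans (ler_norm_sum _ _ _)).
  apply: ler_sum => i _; rewrite normrM mxE.
  by rewrite [`|real_complex R _|]ger0_norm // ler0c.
rewrite exchange_big /= /S big_distrr /=; apply: ler_sum => i _.
rewrite -big_distrr /= mulrC ler_wpM2r // -rmorph_sum lecR.
apply: le_trans (row_le i); rewrite mxE le_eqVlt; apply/orP; left; apply/eqP.
by apply: eq_bigr => j _; rewrite mxE mulr1.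
Qed.

Lemma eigenvalue_exists (R : realType) (n : nat) (B : 'M[R]_n) : (0 < n)%N ->
  exists z, eigenvalue (map_mx (real_complex R) B) z.
Proof.
move=> n_gt0.
set p := char_poly (map_mx (real_complex R) B).
have : size p != 1 by rewrite size_char_poly; lia.
by case/closed_rootP => z pz; exists z; rewrite eigenvalue_root_char.
Qed.

(** The characteristic polynomial splits over the complex numbers; with all roots zero it is ['X^n],
    and Cayley-Hamilton applies. *)
Lemma nilpotent_eigenvalues0 (R : realType) (n : nat) (B : 'M[R]_n) :
  (0 < n)%N ->
  (forall z, eigenvalue (map_mx (real_complex R) B) z -> z = 0) -> B ^+ n = 0.
Proof.
case: n B => // n B _ eig0.
set Bc := map_mx _ B in eig0.
have [rs p_rs] := closed_field_poly_normal (char_poly Bc).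
rewrite (monicP (char_poly_monic Bc)) scale1r in p_rs.
have rs0 z : z \in rs -> z = 0.
  by move=> z_rs; apply: eig0; rewrite eigenvalue_root_char p_rs root_prod_XsubC.
have pX : char_poly Bc = 'X^(size rs).
  rewrite p_rs big_seq (eq_bigr (fun=> 'X)) => [|z /rs0->]; last by rewrite subr0.
  by rewrite -big_seq big_const_seq count_predT iter_mulr_1.
have size_rs : size rs = n.+1.
  by have := size_char_poly Bc; rewrite pX size_polyXn => -[].
have := Cayley_Hamilton Bc; rewrite pX size_rs rmorphXn /= horner_mx_X.
rewrite -[LHS](rmorphXn (@map_mx _ _ (real_complex R) n.+1 n.+1)) => /matrixP Bn0.
by apply/matrixP => i j; have := Bn0 i j; rewrite !mxE => /complexI.
Qed.

Section SpectralRadius.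
Variables (R : realType) (n : nat) (B : 'M[R]_n).
Hypotheses (n_gt0 : (0 < n)%N) (B_ge0 : forall i j, 0 <= B i j).

Let moduli : set R := [set r : R | exists2 z : complex R,
  eigenvalue (map_mx (real_complex R) B) z & `|z| = real_complex R r].

Let modulus (z : complex R) : exists2 r : R, 0 <= r & `|z| = real_complex R r.
Proof.
by rewrite normc_def; eexists; [apply: sqrtr_ge0|reflexivity].
Qed.

(** Every eigenvalue has modulus at most the [k]-th root of [M]. This bounds the supremum because
    the set of moduli is nonempty. *)
Lemma spectral_radius_exp_le (k : nat) (M : R) : (0 < k)%N ->
  (forall i, (B ^+ k *m const_mx 1 : 'cV_n) i 0 <= M) ->
  spectral_radius B ^+ k <= M.
Proof.
move=> k_gt0 row_le.
have [z z_eig] := eigenvalue_exists B n_gt0.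
have [r r_ge0 zr] := modulus z.
have mod_le x : moduli x -> x ^+ k <= M.
  case=> y y_eig yx; rewrite -lecR rmorphXn /= -yx.
  exact: eigenvalue_norm_le row_le y_eig.
have M_ge0 : 0 <= M.
  by apply: le_trans (mod_le r _); [rewrite exprn_ge0|exists z].
pose s := M `^ (k%:R^-1).
have sk : s ^+ k = M.
  by rewrite -powR_mulrn ?powR_ge0 // -powRrM mulVf ?powRr1 // pnatr_eq0 -lt0n.
have sup_le : spectral_radius B <= s.
  apply: ge_sup; first by exists r, z.
  move=> x xP; have [x0|/ltW x_le0] := leP 0 x; last first.
    by rewrite (le_trans x_le0) ?powR_ge0.
  by rewrite -(@ler_pXn2r _ k) ?nnegrE ?powR_ge0 // sk mod_le.
have sup_ge0 : 0 <= spectral_radius B.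
  apply: (le_trans r_ge0); apply: ub_le_sup; last by exists z.
  exists s => x xP; have [x0|/ltW x_le0] := leP 0 x; last first.
    by rewrite (le_trans x_le0) ?powR_ge0.
  by rewrite -(@ler_pXn2r _ k) ?nnegrE ?powR_ge0 // sk mod_le.
by rewrite -sk lerXn2r ?nnegrE ?powR_ge0.
Qed.

(** A matrix that is not nilpotent has a nonzero eigenvalue, whose modulus bounds the supremum from
    below. *)
Lemma spectral_radius_gt0 : B ^+ n != 0 -> 0 < spectral_radius B.
Proof.
move=> Bn_neq0.
have [z z_eig z_neq0] :
    exists2 z, eigenvalue (map_mx (real_complex R) B) z & z != 0.
  apply: contrapT => no_z; move/eqP: Bn_neq0; apply.
  apply: nilpotent_eigenvalues0 => // z z_eig; apply: contrapT => /eqP z_neq0.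
  by apply: no_z; exists z.
have [r r_ge0 zr] := modulus z.
have r_gt0 : 0 < r.
  rewrite lt_def r_ge0 andbT; apply: contra z_neq0 => /eqP r0.
  by rewrite -normr_eq0 zr r0.
apply: (lt_le_trans r_gt0); apply: ub_le_sup; last by exists z.
(* The supremum dominates its members once the set is bounded; the sum of all entries of [B] is a
   bound. *)
exists (\sum_i (B *m const_mx 1 : 'cV_n) i 0) => x [y y_eig yx].
rewrite -lecR -yx -[leLHS]expr1; apply: eigenvalue_norm_le y_eig => // i.
rewrite expr1 [leRHS](bigD1 i) //= lerDl sumr_ge0 // => j _.
by rewrite mxE sumr_ge0 // => l _; rewrite mxE mulr1.
Qed.

End SpectralRadius.

(** * Markovian automata *)

Lemma connect_backward_ind (T : finType) (e : rel T) (P : T -> Prop) (y : T) :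
  (forall x z, e x z -> P z -> P x) -> P y -> forall x, connect e x y -> P x.
Proof.
move=> P_step Py x /connectP[p e_p y_eq].
elim: p x e_p y_eq => /= [x _ <- //|z p IHp x /andP[exz e_p] y_eq].
exact: P_step exz (IHp _ e_p y_eq).
Qed.

Lemma finite_pos_lower_bound (R : realType) (T : finType) (F : T -> R) :
  (forall x, 0 < F x) -> exists2 c : R, 0 < c & forall x, c <= F x.
Proof.
move=> F_gt0; have S_ge0 : 0 <= \sum_x (F x)^-1.
  by apply: sumr_ge0 => x _; rewrite invr_ge0 ltW.
exists (1 + \sum_x (F x)^-1)^-1 => [|x]; first by rewrite invr_gt0; lra.
rewrite -[leRHS]invrK lef_pV2 ?posrE ?invr_gt0 //; last lra.
rewrite (bigD1 x) //= addrCA lerDl addr_ge0 //.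
by apply: sumr_ge0 => z _; rewrite invr_ge0 ltW.
Qed.

Section Automaton.
Variables (R : realType) (A : finType) (X : markov_automaton R A).
Implicit Types (p q : state X) (a b : letter A) (k : nat).

Lemma gam_ge0 q a : 0 <= gam q a.
Proof. by case: (gam_prob q). Qed.

Lemma sum_gam q : \sum_a gam q a = 1.
Proof. by case: (gam_prob q). Qed.

Lemma gam_le1 q a : gam q a <= 1.
Proof.
rewrite -(sum_gam q) (bigD1 a) //= lerDl; apply: sumr_ge0 => b _.
exact: gam_ge0.
Qed.

Lemma gam_trans_None q a : trans q a = None -> gam q a = 0.
Proof. by move/gam_eq0. Qed.

Lemma exists_gam_gt0 q :
  exists (a : letter A) (p : state X), trans q a = Some p /\ 0 < gam q a.
Proof.
have [a qa] : exists a, gam q a != 0.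
  apply: contrapT => no_a; have := oner_neq0 R; rewrite -(sum_gam q).
  rewrite big1 ?eqxx // => a _; apply: contrapT => /eqP qa.
  by apply: no_a; exists a.
case ta: (trans q a) => [p|]; last by rewrite (gam_trans_None ta) eqxx in qa.
by exists a, p; rewrite lt_def qa gam_ge0.
Qed.

Lemma init_ge0 q : 0 <= init q.
Proof. by case: (init_prob X). Qed.

Lemma gam_word_ge0 q u : 0 <= gam_word q u.
Proof.
elim: u q => //= a u IHu q; case: trans => // q'.
by rewrite mulr_ge0 ?gam_ge0.
Qed.

Lemma gam_word_cat q u w :
  gam_word q (u ++ w) = gam_word q u * oapp (fun p => gam_word p w) 0 (run q u).
Proof.
elim: u q => [|a u IHu] q /=; first by rewrite mul1r.
by case: trans => [q'|] /=; rewrite ?mul0r // IHu mulrA.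
Qed.

Lemma gam_word_eq0 q u : run q u = None -> gam_word q u = 0.
Proof.
elim: u q => //= a u IHu q; case: trans => // q' /= /IHu->.
by rewrite mulr0.
Qed.

Lemma sum_gam_word k q : \sum_(u : k.-tuple (letter A)) gam_word q u = 1.
Proof.
elim: k q => [|k IHk] q; first by rewrite (big_tuple0 xpredT (gam_word q)).
rewrite (big_cons_tuple _ xpredT (gam_word q)) -(sum_gam q).
apply: eq_bigr => a _ /=; case ta: (trans q a) => [q'|].
  by rewrite -big_distrr /= IHk mulr1.
by rewrite big1 // gam_trans_None.
Qed.

Lemma init_word_ge0 u : 0 <= init_word X u.
Proof.
by apply: sumr_ge0 => q _; rewrite mulr_ge0 ?gam_word_ge0 ?init_ge0.
Qed.

Lemma sum_init_word k : \sum_(u : k.-tuple (letter A)) init_word X u = 1.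
Proof.
rewrite exchange_big /=; have [_ <-] := init_prob X.
by apply: eq_bigr => q _; rewrite -big_distrr /= sum_gam_word mulr1.
Qed.

Lemma init_word_ge q u : init q * gam_word q u <= init_word X u.
Proof.
rewrite /init_word (bigD1 q) //= lerDl; apply: sumr_ge0 => p _.
by rewrite mulr_ge0 ?gam_word_ge0 ?init_ge0.
Qed.

(** Sorts the letters by the state they lead to. This turns recursions on words into sums against
    matrix entries. *)
Lemma sum_trans q (G : letter A -> state X -> R) :
  \sum_a oapp (G a) 0 (trans q a) = \sum_p \sum_(a | trans q a == Some p) G a p.
Proof.
rewrite (exchange_big_dep predT) //=; apply: eq_bigr => a _.
case: trans => [r|] /=; last by rewrite big_pred0.
rewrite (bigD1 r) //= big1 ?addr0 // => p.
by case/andP => /eqP[->]; rewrite eqxx.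
Qed.

Lemma step_ge0 p q : 0 <= step p q.
Proof. by apply: sumr_ge0 => a _; exact: gam_ge0. Qed.

Lemma sum_step q : \sum_p step q p = 1.
Proof.
rewrite -(sum_trans q (fun a _ => gam q a)) -(sum_gam q).
by apply: eq_bigr => a _; case ta: (trans q a) => [p|] //=; rewrite gam_trans_None.
Qed.

Lemma edge_step_gt0 p q : edge p q -> 0 < step p q.
Proof.
case/existsP => a /eqP pa; rewrite /step (bigD1 a) ?pa //=.
rewrite ltr_wpDr ?sumr_ge0 // => [b _|]; first exact: gam_ge0.
by rewrite lt_def gam_ge0 andbT; apply/eqP => /gam_eq0; rewrite pa.
Qed.

(** * Words whose last letter is not the inverse of a given letter *)

Section LastLetter.
Variable a0 : letter A.

(* For k = 0, this is the constant 1 as a0 is never its own inverse. *)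
Definition last_mass k q : R :=
  \sum_(w : k.-tuple (letter A) | last a0 w != linv a0) gam_word q w.

Lemma last_mass_ge0 k q : 0 <= last_mass k q.
Proof. by apply: sumr_ge0 => w _; apply: gam_word_ge0. Qed.

(** The recursion starts at length two: only a nonempty tail determines the last letter by
    itself. *)
Lemma last_massS k q :
  last_mass k.+2 q = \sum_p step q p * last_mass k.+1 p.
Proof.
rewrite /last_mass.
rewrite (big_cons_tuple _ (fun w => last a0 w != linv a0) (gam_word q)).
under [RHS]eq_bigr do rewrite /step big_distrl /=.
rewrite -(sum_trans q (fun a p => gam q a * last_mass k.+1 p)).
apply: eq_bigr => a _ /=; case: trans => [p|] /=; last by rewrite big1.
by rewrite big_distrr /=; apply: eq_bigl => w; case/tupleP: w.
Qed.

Lemma last_mass1_gt0 p : gam p (linv a0) != 1 -> 0 < last_mass 1 p.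
Proof.
move=> gam_neq1; rewrite /last_mass.
rewrite (big_cons_tuple _ (fun w => last a0 w != linv a0) (gam_word p)) /=.
apply: (@lt_le_trans _ _ (1 - gam p (linv a0))).
  by rewrite subr_gt0 lt_def eq_sym gam_neq1 gam_le1.
rewrite -(sum_gam p) (bigD1 (linv a0)) //= addrAC subrr add0r.
rewrite [leLHS]big_mkcond; apply: ler_sum => a _.
rewrite (big_tuple0 (fun w : seq _ => last a w != linv a0)
  (fun w : seq _ => gam_word p (a :: w))) /=.
case: ifP => // _; case pa: (trans p a) => [p'|]; first by rewrite mulr1.
by rewrite gam_trans_None.
Qed.

Lemma last_mass_exp k q : last_mass k.+1 q =
  \sum_p (fin_mx (@step _ _ X) ^+ k) (enum_rank q) (enum_rank p) * last_mass 1 p.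
Proof.
elim: k q => [|k IHk] q.
  rewrite (bigD1 q) //= expr0 mxE eqxx mul1r big1 ?addr0 // => p pq.
  by rewrite mxE (inj_eq enum_rank_inj) eq_sym (negPf pq) mul0r.
rewrite last_massS; under eq_bigr do rewrite IHk big_distrr /=.
rewrite exchange_big /=; apply: eq_bigr => p _.
rewrite exprS mxE big_distrl /= (reindex (@enum_rank (state X))) /=; last first.
  exact: onW_bij (enum_rank_bij _).
by apply: eq_bigr => r _; rewrite mxE !enum_rankK mulrA.
Qed.

(** For all large [k], the automaton can return from [p] to [p] in [k] steps and then read a letter
    other than [linv a0]. Strong connectivity carries this positivity back to every state, and
    finiteness makes it uniform. *)
Lemma last_mass_lower_bound p : ergodic X -> gam p (linv a0) != 1 ->
  exists2 c : R, 0 < c & \forall k \near \oo, forall q, c <= last_mass k q.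
Proof.
move=> [X_conn X_aper] p_neq1.
have near_gt0 q : \forall k \near \oo, 0 < last_mass k.+1 q.
  elim/connect_backward_ind: q / (X_conn q p) => [r s rs|].
    move=> s_gt0; have : \forall k \near \oo, 0 < last_mass k.+2 r.
      near=> k; rewrite last_massS (bigD1 s) //=.
      rewrite ltr_wpDr ?sumr_ge0 // => [t _|].
        by rewrite mulr_ge0 ?step_ge0 ?last_mass_ge0.
      rewrite mulr_gt0 ?edge_step_gt0 //; near: k; exact: s_gt0.
    exact: (near_inftyS (fun k => 0 < last_mass k.+1 r)).
  near=> k; rewrite last_mass_exp (bigD1 p) //=.
  rewrite ltr_wpDr ?sumr_ge0 // => [t _|].
    rewrite mulr_ge0 ?last_mass_ge0 // expmx_ge0 // => i j.
    by rewrite mxE step_ge0.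
  by rewrite mulr_gt0 ?last_mass1_gt0 //; move: p {p_neq1}; near: k.
have : \forall k \near \oo, forall q, 0 < last_mass k.+1 q.
  exact: filter_forall.
case=> K _ K_gt0.
have [c c_gt0 c_le] := finite_pos_lower_bound (K_gt0 K (leqnn K)).
exists c => //; exists K.+1 => // k /= lt_Kk.
(* Each later mass is an average of masses at the preceding length, so the bound [c] persists. *)
rewrite -(subnK lt_Kk); elim: (k - K.+1)%N => // n IHn q.
rewrite !addSn addnS last_massS -(mul1r c) -(sum_step q) big_distrl /=.
apply: ler_sum => r _; rewrite ler_wpM2l ?step_ge0 //.
by rewrite -addnS IHn.
Unshelve. all: by end_near.
Qed.

End LastLetter.

(** * Coincidence of two independent words read from the same state *)

Definition square_mass k q : R :=
  \sum_(u : k.-tuple (letter A)) gam_word q u ^+ 2.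

Lemma square_mass0 q : square_mass 0 q = 1.
Proof. by rewrite /square_mass (big_tuple0 xpredT (fun u => gam_word q u ^+ 2)) expr1n. Qed.

Lemma square_massS k q : square_mass k.+1 q =
  \sum_a oapp (fun p => gam q a ^+ 2 * square_mass k p) 0 (trans q a).
Proof.
rewrite /square_mass (big_cons_tuple _ xpredT (fun u => gam_word q u ^+ 2)).
apply: eq_bigr => a _ /=; case: trans => [p|] /=.
  by rewrite big_distrr /=; apply: eq_bigr => u _; rewrite exprMn.
by rewrite big1 // => u _; rewrite expr0n.
Qed.

Lemma square_mass_ge0 k q : 0 <= square_mass k q.
Proof. by apply: sumr_ge0 => u _; rewrite exprn_ge0 ?gam_word_ge0. Qed.

(** Words that coincide have coinciding prefixes. *)
Lemma square_mass_decr k q : square_mass k.+1 q <= square_mass k q.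
Proof.
elim: k q => [|k IHk] q.
  rewrite square_massS square_mass0 -(sum_gam q); apply: ler_sum => a _.
  case: trans => [p|] /=; last exact: gam_ge0.
  by rewrite square_mass0 mulr1 expr2 ler_piMl ?gam_ge0 ?gam_le1.
rewrite square_massS [leRHS]square_massS; apply: ler_sum => a _.
by case: trans => //= p; rewrite ler_wpM2l ?exprn_ge0 ?gam_ge0.
Qed.

Lemma square_mass_le k l q : (k <= l)%N -> square_mass l q <= square_mass k q.
Proof.
move=> /subnK <-; elim: (l - k)%N => // n IHn.
exact: le_trans (square_mass_decr _ _) IHn.
Qed.

Lemma square_mass_le1 k q : square_mass k q <= 1.
Proof. by rewrite -(square_mass0 q) square_mass_le. Qed.

Lemma square_mass_gt0 k q : 0 < square_mass k q.
Proof.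
elim: k q => [|k IHk] q; first by rewrite square_mass0.
have [a [p [ta qa]]] := exists_gam_gt0 q.
rewrite square_massS (bigD1 a) //= ltr_wpDr ?sumr_ge0 // => [b _|].
  by case: trans => //= r; rewrite mulr_ge0 ?exprn_ge0 ?gam_ge0 ?square_mass_ge0.
by rewrite ta /= mulr_gt0 // exprn_gt0.
Qed.

(** Along a transition from [r] to [s] by [a], forcing the first letter costs a factor
    [gam r a ^+ 2] and, by monotonicity, no change of length. Composing along a path to [q] gives a
    constant independent of [k]. *)
Lemma square_mass_comparable p : ergodic X ->
  exists2 c : R, 0 < c & forall k q, c * square_mass k q <= square_mass k p.
Proof.
case=> X_conn _.
have cmp q : exists c, 0 < c /\ forall k, c * square_mass k q <= square_mass k p.
  elim/connect_backward_ind: p / (X_conn p q) => [r s /existsP[a /eqP ra]|].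
    case=> c [c_gt0 c_le]; have ra_gt0 : 0 < gam r a.
      by rewrite lt_def gam_ge0 andbT; apply/eqP => /gam_eq0; rewrite ra.
    exists (gam r a ^+ 2 * c); split=> [|k].
      by rewrite mulr_gt0 ?exprn_gt0.
    apply: le_trans (square_mass_decr k r); rewrite square_massS (bigD1 a) //= ra.
    rewrite /= -[leLHS]addr0; apply: lerD; last first.
      apply: sumr_ge0.
      by move=> b _; case: trans => //= t; rewrite mulr_ge0 ?sqr_ge0 ?square_mass_ge0.
    by rewrite -mulrA ler_wpM2l ?sqr_ge0.
  by exists 1; split=> // k; rewrite mul1r.
have [f fP] := choice cmp.
have [c c_gt0 c_le] := finite_pos_lower_bound (fun q => (fP q).1).
exists c => // k q; apply: le_trans ((fP q).2 k).
by rewrite ler_wpM2r ?square_mass_ge0.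
Qed.

Lemma square_mass1_step q : (forall k, square_mass k q = 1) ->
  exists a p, [/\ trans q a = Some p, gam q a = 1
    & forall k, square_mass k p = 1].
Proof.
move=> q1.
have [a [p [ta qa]]] := exists_gam_gt0 q.
have eq1 k : gam q a * square_mass k p = 1.
  (* Every term is nonnegative and the total is [1 - square_mass k.+1 q = 0], so every term
     vanishes. *)
  have : \sum_b (gam q b -
      oapp (fun p => gam q b ^+ 2 * square_mass k p) 0 (trans q b)) = 0.
    by rewrite sumrB -square_massS sum_gam q1 subrr.
  move/psumr_eq0P => /(_ _ a isT) /=; rewrite ta /= => sum0.
  apply: (mulfI (lt0r_neq0 qa)); rewrite mulr1 mulrA -expr2; apply/eqP.
  rewrite eq_sym -subr_eq0; apply/eqP/sum0 => b _.
  case: trans => /= [r|]; last by rewrite subr0 gam_ge0.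
  rewrite subr_ge0 expr2 -mulrA ler_piMr ?gam_ge0 //.
  by rewrite mulr_ile1 ?gam_ge0 ?square_mass_ge0 ?gam_le1 ?square_mass_le1.
have gam1 : gam q a = 1 by have := eq1 0%N; rewrite square_mass0 mulr1.
by exists a, p; split=> // k; have := eq1 k; rewrite gam1 mul1r.
Qed.

(** By monotonicity, a state violating the bound at arbitrarily large lengths has square mass 1 at
    all lengths. Its transitions of probability 1 can then be followed forever, and the pigeonhole
    principle closes a cycle. *)
Lemma square_mass_lt1 : ~ has_prob1_cycle X ->
  exists2 k, (0 < k)%N & forall q, square_mass k q < 1.
Proof.
move=> no_cycle.
have near_lt1 q : \forall k \near \oo, square_mass k q < 1.
  apply: contrapT => not_near; apply: no_cycle.
  have q1 : forall k, square_mass k q = 1.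
    move=> k; apply: contrapT => /eqP k_neq1; apply: not_near.
    exists k => // l /= le_kl; apply: le_lt_trans (square_mass_le q le_kl) _.
    by rewrite lt_neqAle k_neq1 square_mass_le1.
  (* The letter chosen at states without the property is arbitrary; it only makes the choice
     function total. *)
  have step_ex r : exists ap : letter A * state X,
      (forall k, square_mass k r = 1) -> [/\ trans r ap.1 = Some ap.2,
        gam r ap.1 = 1 & forall k, square_mass k ap.2 = 1].
    have [r1|r1] := pselect (forall k, square_mass k r = 1).
      by have [a [p ?]] := square_mass1_step r1; exists (a, p).
    have [a _] := square_mass1_step q1.
    by exists (a, r) => /r1.
  have [f fP] := choice step_ex.
  pose nx r := (f r).2.
  have word_ex k r : (forall k, square_mass k r = 1) ->
      exists u, [/\ size u = k, run r u = Some (iter k nx r) & gam_word r u = 1].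
    elim: k r => [|k IHk] r r1; first by exists [::].
    have [tr gr nr1] := fP r r1.
    have [u [su ru gu]] := IHk _ nr1; exists ((f r).1 :: u); split=> /=.
    - by rewrite su.
    - by rewrite tr /= ru -iterS iterSr.
    - by rewrite tr gr gu mul1r.
  have iter1 i : forall k, square_mass k (iter i nx q) = 1.
    by elim: i => //= i IHi; case: (fP _ IHi).
  have : ~~ injectiveb (fun i : 'I_#|state X|.+1 => iter i nx q).
    by apply/negP => /injectiveP/leq_card; rewrite card_ord ltnn.
  case/injectivePn => i [j ij /= eq_ij].
  wlog lt_ij : i j ij eq_ij / (i < j)%N.
    move=> hw; case: (ltngtP i j) => [|ji|/val_inj eij]; first exact: hw.
      by apply: (hw j i); rewrite // eq_sym.
    by rewrite eij eqxx in ij.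
  have [u [su ru gu]] := word_ex (j - i)%N _ (iter1 i).
  exists (iter i nx q), u; split=> //; last first.
    by rewrite ru -iterD subnK ?eq_ij // ltnW.
  move=> u0; move: su; rewrite u0 /= => /esym/eqP.
  by rewrite subn_eq0 leqNgt lt_ij.
have : \forall k \near \oo, forall q, square_mass k q < 1 by exact: filter_forall.
case=> K _ KP; exists K.+1 => //; apply: KP => /=; exact: leqnSn.
Qed.

(** * The matrix on state-letter pairs and its spectral radius *)

Lemma sum_lstate (G : state X * letter A -> R) :
  (forall qa, ~~ [exists p, trans p qa.2 == Some qa.1] -> G qa = 0) ->
  \sum_(y : lstate X) G (val y) = \sum_qa G qa.
Proof.
move=> G0; rewrite [RHS](bigID (fun qa => [exists p, trans p qa.2 == Some qa.1])).
rewrite /= [X in _ + X]big1 ?addr0 //.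
rewrite [RHS](reindex_omap (val : lstate X -> _) insub) /=; last first.
  by move=> qa qaP; rewrite insubT.
by apply: eq_bigl => y; rewrite (valP y) valK eqxx.
Qed.

Let B := fin_mx (fun x y : lstate X => lstep x y ^+ 2).

(** The weights leaving a pair depend only on its state, so the row sums obey the recursion
    [square_massS]. *)
Lemma lstep_exp_square_mass k i :
  (B ^+ k *m const_mx 1 : 'cV_(#|lstate X|)) i 0 =
  square_mass k (val (enum_val i)).1.
Proof.
elim: k i => [|k IHk] i.
  by rewrite expr0 square_mass0 mul1mx mxE.
rewrite exprS -[_ * _]/(_ *m _) -mulmxA mxE.
under eq_bigr do rewrite IHk mxE.
set x := enum_val i; set q := (val x).1.
(* [G] extends the summand to all pairs; it vanishes on those that no transition enters. *)
pose G (qa : state X * letter A) :=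
  (if trans q qa.2 == Some qa.1 then gam q qa.2 else 0) ^+ 2 *
  square_mass k qa.1.
rewrite -(big_enum_val (fun y : lstate X => G (val y))) /=.
rewrite sum_lstate => [|[r a] /= /existsPn no_p]; last first.
  by rewrite /G /= (negPf (no_p q)) expr0n mul0r.
rewrite square_massS (sum_trans q (fun a p => gam q a ^+ 2 * square_mass k p)).
rewrite -(pair_bigA _ (fun r a => G (r, a))) /=; apply: eq_bigr => r _.
rewrite [RHS]big_mkcond; apply: eq_bigr => a _.
by rewrite /G /=; case: ifP; rewrite // expr0n mul0r.
Qed.

Lemma card_lstate_gt0 : (0 < #|lstate X|)%N.
Proof.
have /card_gt0P[q _] := state_nonempty X.
have [a [p [ta qa]]] := exists_gam_gt0 q.
have paP : [exists r, trans r (p, a).2 == Some (p, a).1].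
  by apply/existsP; exists q; rewrite ta.
by apply/card_gt0P; exists (Sub (p, a) paP).
Qed.

Lemma lstep_mx_ge0 i j : 0 <= B i j.
Proof. by rewrite mxE sqr_ge0. Qed.

Lemma coincidence_prob_exp_le k (M : R) : (0 < k)%N ->
  (forall q, square_mass k q <= M) -> coincidence_prob X ^+ k <= M.
Proof.
move=> k_gt0 M_ge; apply: spectral_radius_exp_le => //.
- exact: card_lstate_gt0.
- exact: lstep_mx_ge0.
- by move=> i; rewrite lstep_exp_square_mass.
Qed.

(** The row sums of the powers of [B] are positive, so [B] is not nilpotent. *)
Lemma coincidence_prob_gt0 : 0 < coincidence_prob X.
Proof.
apply: spectral_radius_gt0; [exact: card_lstate_gt0|exact: lstep_mx_ge0|].
apply/eqP => Bn0; have := lstep_exp_square_mass #|lstate X| (Ordinal card_lstate_gt0).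
rewrite Bn0 mul0mx mxE => /esym/eqP; apply/negP.
by rewrite gt_eqF // square_mass_gt0.
Qed.

Lemma coincidence_prob_lt1 : ~ has_prob1_cycle X -> coincidence_prob X < 1.
Proof.
case/square_mass_lt1 => k k_gt0 k_lt1.
have pos q : 0 < 1 - square_mass k q by rewrite subr_gt0.
have [c c_gt0 c_le] := finite_pos_lower_bound pos.
have : coincidence_prob X ^+ k <= 1 - c.
  by apply: coincidence_prob_exp_le => // q; rewrite lerBrDr -lerBrDl.
rewrite -(@expr_lt1 _ k) //; last exact/ltW/coincidence_prob_gt0.
by move/le_lt_trans; apply; lra.
Qed.

(** The spectral bound applies to [M = square_mass k p / c], which dominates the square masses of
    all states by comparability. It requires a positive power, hence the separate case of length
    0. *)
Lemma square_mass_ge p : ergodic X ->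
  exists2 c : R, 0 < c & forall k, c * coincidence_prob X ^+ k <= square_mass k p.
Proof.
case/(square_mass_comparable p) => c c_gt0 c_le; exists c => // -[|k].
  by have := c_le 0%N p; rewrite !square_mass0 expr0.
rewrite -ler_pdivlMl //; apply: coincidence_prob_exp_le => // q.
by rewrite ler_pdivlMl.
Qed.

End Automaton.

(** * Prefix collisions under the conditional law *)

Lemma size_sym_tuple (A : finType) (h : seq (seq (letter A))) :
  size (sym_tuple h) = (size h).*2.
Proof. by elim: h => //= w h ->. Qed.

Lemma nth_sym_tuple_double (A : finType) (h : seq (seq (letter A))) (i : nat) :
  nth [::] (sym_tuple h) i.*2 = nth [::] h i.
Proof. by elim: h i => [|w h IHh] [|i] //=; rewrite ?nth_nil //= IHh. Qed.

(** The common prefix occurs at position 0 of two entries of even index, where the words themselves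
    stand. Occurrences are told apart by index, so the two words may even be equal. *)
Lemma common_prefix_not_small_cancellation (R : realType) (A : finType)
    (lambda : R) (h : seq (seq (letter A))) (m n : nat) :
  (0 < n)%N -> (m <= n)%N -> lambda * n%:R <= m%:R ->
  (forall w, w \in h -> size w = n) -> ~~ uniq (map (take m) h) ->
  ~ small_cancellation lambda h.
Proof.
move=> n_gt0 le_mn lambda_le h_size /(uniqPn [::])[i [j []]].
rewrite size_map => lt_ij lt_jh; have lt_ih := ltn_trans lt_ij lt_jh.
rewrite !(nth_map [::]) // => eq_take; pose u := take m (nth [::] h i).
have size_nth l : (l < size h)%N -> size (nth [::] h l) = n.
  by move=> lt_l; apply/h_size/mem_nth.
have occ l : (l < size h)%N -> u = take m (nth [::] h l) ->
    occurs_at h u (l.*2, 0%N).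
  move=> lt_l ->; rewrite /occurs_at /= size_sym_tuple ltn_double.
  by rewrite nth_sym_tuple_double size_nth // rot0 prefix_take.
move/(_ u (i.*2, 0%N)); rewrite nth_sym_tuple_double size_nth //.
rewrite size_takel ?size_nth // ltNge lambda_le /=.
case/(_ _ (occ i lt_ih erefl))/notF.
exists (i.*2, 0%N), (j.*2, 0%N); split; [|exact: occ..].
by case=> /double_inj eq_ij; rewrite eq_ij ltnn in lt_ij.
Qed.

(** Otherwise [linv a] is forced in every state for each [a] that can start a word. The sum in
    [non_degenerate] then reduces to the total mass of the first letter, which is 1. *)
Lemma non_degenerate_witness (R : realType) (A : finType)
    (X : markov_automaton R A) (v : state X -> R) :
  stationary v -> non_degenerate v ->
  exists (q : state X) (a : letter A) (p : state X),
    [/\ init q != 0, gam q a != 0 & gam p (linv a) != 1].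
Proof.
move=> [[_ v_sum1] _] v_nondeg; apply: contrapT => no_wit; apply: v_nondeg.
transitivity (\sum_a letter_prob (@init _ _ X) a).
  apply: eq_bigr => a _.
  have [->|/eqP init_a] := eqVneq (letter_prob (@init _ _ X) a) 0.
    by rewrite mul0r.
  have [q] : exists q : state X, init q * gam q a != 0.
    apply: contrapT => no_q; apply: init_a; apply: big1 => q _.
    by apply: contrapT => /eqP qa; apply: no_q; exists q.
  rewrite mulf_eq0 negb_or => /andP[init_q gam_q].
  rewrite -[RHS]mulr1; congr (_ * _); rewrite -v_sum1; apply: eq_bigr => p _.
  rewrite -[RHS]mulr1; congr (_ * _); apply: contrapT => /eqP gam_p.
  by apply: no_wit; exists q, a, p.
rewrite exchange_big /=; have [_ <-] := init_prob X.
by apply: eq_bigr => q _; rewrite -big_distrr /= sum_gam mulr1.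
Qed.

Section ConditionalLaw.
Variables (R : realType) (A : finType) (X : markov_automaton R A).
Hypothesis X_reduced : forall u : seq (letter A), init_word X u <> 0 -> reduced u.
Variables (q0 q1 : state X) (a : letter A) (c : R) (m k : nat).
Hypotheses (init_q0 : 0 < init q0) (gam_q0 : 0 < gam q0 a).
Hypothesis trans_q0 : trans q0 a = Some q1.
Hypotheses (c_gt0 : 0 < c) (k_gt0 : (0 < k)%N).
Hypothesis last_mass_ge : forall q : state X, c <= last_mass a k q.

(** Words are split into the letter [a], a middle of length [m] and an end of length [k]. [D]
    accounts for the choice of [q0], the letter [a] and an admissible end, whatever the middle. *)
Let D := init q0 * gam q0 a * c.
Let n := (m.+1 + k)%N.

(** Words of nonzero mass are reduced, so cyclic reduction only constrains the last letter, which
    lies in [w] as [k] is positive. *)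
Lemma cyc_reduced_extension_ge (u : seq (letter A)) :
  D * gam_word q1 u <= \sum_(w : k.-tuple (letter A) | cyc_reduced (a :: u ++ w))
    init_word X (a :: u ++ w).
Proof.
apply: (@le_trans _ _ (\sum_(w : k.-tuple (letter A) | last a w != linv a)
    init q0 * gam_word q0 (a :: u ++ w))); last first.
  rewrite [leLHS]big_mkcond [leRHS]big_mkcond /=; apply: ler_sum => w _.
  have last_w : last (last a u) w = last a w.
    have : (0 < size w)%N by rewrite size_tuple.
    by case: (tval w).
  have [w0|/eqP/X_reduced] := eqVneq (init_word X (a :: u ++ w)) 0.
    have le_w := init_word_ge q0 (a :: u ++ w).
    by rewrite w0 in le_w *; rewrite if_same; case: ifP => // _; exact: le_w.
  rewrite /= => ->; rewrite last_cat last_w /=; case: ifP => // _.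
  exact: (init_word_ge q0 (a :: u ++ w)).
rewrite /= trans_q0 -big_distrr /=.
under eq_bigr do rewrite gam_word_cat.
case run_u: (run q1 u) => [r|]; last first.
  rewrite (gam_word_eq0 run_u) mulr0 mulr_ge0 //; first exact: ltW.
  by apply: sumr_ge0 => w _; rewrite mul0r mulr0.
rewrite /= -!big_distrr /= /D -!mulrA !ler_pM2l //.
by rewrite mulrC ler_wpM2l ?gam_word_ge0 //; exact: last_mass_ge.
Qed.

Lemma cyc_reduced_mass_gt0 : 0 < cyc_reduced_mass X n.
Proof.
apply: (@lt_le_trans _ _ D); first by rewrite !mulr_gt0.
rewrite /cyc_reduced_mass /n (big_cat_tuple _ _ (@cyc_reduced A) (init_word X)).
rewrite (big_cons_tuple _ xpredT (fun u =>
  \sum_(w : k.-tuple _ | cyc_reduced (u ++ w)) init_word X (u ++ w))).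
rewrite (bigD1 a) //= -[D]addr0 lerD //; last first.
  apply: sumr_ge0 => b _; apply: sumr_ge0 => u _; apply: sumr_ge0 => w _.
  exact: init_word_ge0.
rewrite -[D]mulr1 -(sum_gam_word m q1) big_distrr /=.
by apply: ler_sum => u _; apply: cyc_reduced_extension_ge.
Qed.

Lemma cyc_reduced_mass_le1 : cyc_reduced_mass X n <= 1.
Proof.
rewrite -(sum_init_word X n) /cyc_reduced_mass big_mkcond; apply: ler_sum => v _.
by case: ifP => // _; apply: init_word_ge0.
Qed.

Lemma cond_law_prob : prob_vector (@cond_law R A X n).
Proof.
split=> [v|].
  by rewrite /cond_law; case: ifP => // _; rewrite divr_ge0 ?init_word_ge0 ?ltW
    ?cyc_reduced_mass_gt0.
rewrite /cond_law -big_mkcond -big_distrl /= divff //.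
by rewrite gt_eqF ?cyc_reduced_mass_gt0.
Qed.

(** The conditional law extended to sequences, so that sums can be split along concatenations. *)
Let cond_word (s : seq (letter A)) : R :=
  if cyc_reduced s then init_word X s / cyc_reduced_mass X n else 0.

Let cond_word_ge0 s : 0 <= cond_word s.
Proof.
rewrite /cond_word; case: ifP => // _.
by rewrite divr_ge0 ?init_word_ge0 ?ltW ?cyc_reduced_mass_gt0.
Qed.

(** Conditioning divides by a mass at most 1, so it preserves the lower bound. *)
Let prefix_mass_ge (u : seq (letter A)) :
  D * gam_word q1 u <= \sum_(w : k.-tuple (letter A)) cond_word (a :: u ++ w).
Proof.
apply: (le_trans (cyc_reduced_extension_ge u)).
rewrite [leLHS]big_mkcond; apply: ler_sum => w _; rewrite /cond_word.
case: ifP => // _; rewrite ler_pdivlMr ?cyc_reduced_mass_gt0 //.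
by rewrite ler_piMr ?init_word_ge0 ?cyc_reduced_mass_le1.
Qed.

(** The collision probability is the sum of the squared prefix masses; only prefixes starting with
    [a] are kept. *)
Lemma prefix_collision_ge : D ^+ 2 * square_mass m q1 <=
  \sum_(t : n.-tuple (letter A)) cond_law X t *
    class_mass (@cond_law R A X n) (fun t => take m.+1 t) t.
Proof.
pose F s := cond_word s *
  \sum_(x : n.-tuple (letter A) | take m.+1 x == take m.+1 s) cond_word x.
have F_ge0 s : 0 <= F s by rewrite mulr_ge0 // sumr_ge0.
rewrite -[leRHS]/(\sum_(t : n.-tuple (letter A)) F t).
rewrite /n (big_cat_tuple _ _ xpredT F).
rewrite (big_cons_tuple _ xpredT (fun u => \sum_(w : k.-tuple _) F (u ++ w))).
rewrite (bigD1 a) //= -[leLHS]addr0 lerD //; last first.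
  by apply: sumr_ge0 => b _; apply: sumr_ge0 => u _; apply: sumr_ge0.
rewrite big_distrr /=; apply: ler_sum => u _.
apply: (@le_trans _ _ ((\sum_(w : k.-tuple (letter A)) cond_word (a :: u ++ w)) ^+ 2)).
  rewrite -exprMn lerXn2r ?nnegrE ?prefix_mass_ge ?sumr_ge0 //.
  by rewrite mulr_ge0 ?gam_word_ge0 // !mulr_ge0 // ltW.
rewrite expr2 big_distrl /=; apply: ler_sum => w _; rewrite ler_wpM2l //.
rewrite /n (big_cat_tuple _ _
  (fun x => take m.+1 x == take m.+1 (a :: u ++ w)) cond_word).
rewrite (bigD1 [tuple of a :: u]) //= -[leLHS]addr0 lerD //.
  have takeE (w' : k.-tuple (letter A)) : take m.+1 (a :: u ++ w') = a :: u.
    by rewrite /= take_size_cat ?size_tuple.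
  rewrite [leRHS](eq_bigl xpredT) // => w'.
  exact/eqP/(etrans (takeE w') (esym (takeE w))).
by apply: sumr_ge0 => u' _; apply: sumr_ge0.
Qed.

Lemma tuple_prob_le1 (N : nat) (E : set (seq (seq (letter A)))) :
  tuple_prob X n N E <= 1.
Proof.
have [cond_ge0 cond_sum1] := cond_law_prob.
rewrite -[leRHS](expr1n R N) -cond_sum1 -(sum_prod_tuple _ _ xpredT).
rewrite [leRHS](eq_bigl xpredT) => [|h]; last by rewrite all_predT.
rewrite /tuple_prob big_mkcond; apply: ler_sum => h _; rewrite big_tuple.
by case: ifP => // _; apply: prodr_ge0 => i _.
Qed.

Lemma tuple_prob_not_small_cancellation_ge (N : nat) (lambda s : R) :
  lambda * n%:R <= m.+1%:R -> (1 < N)%N -> 0 < s ->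
  s ^+ 2 <= D ^+ 2 * square_mass m q1 ->
  1 - (N./2%:R * s)^-1 <=
  tuple_prob X n N [set h | ~ small_cancellation lambda h].
Proof.
move=> lambda_le N_gt1 s_gt0 s_le.
have cond_prob := cond_law_prob; have [cond_ge0 cond_sum1] := cond_prob.
have := uniq_sample_le cond_prob s_gt0 (le_trans s_le prefix_collision_ge) N_gt1.
set f := fun t : n.-tuple (letter A) => take m.+1 t.
set U := \sum_(h | _) _ => U_le.
have : (\sum_(t : n.-tuple (letter A)) cond_law X t) ^+ N =
    U + \sum_(h : N.-tuple (n.-tuple (letter A)) | ~~ uniq (map f h))
    \prod_(x <- h) cond_law X x.
  rewrite -(sum_prod_tuple _ _ xpredT).
  rewrite [LHS](eq_bigl xpredT) => [|h]; last by rewrite all_predT.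
  by rewrite (bigID (fun h : N.-tuple _ => uniq (map f h))).
rewrite cond_sum1 expr1n => total; rewrite [X in X - _]total.
rewrite addrAC -[leRHS]add0r lerD ?subr_le0 //.
rewrite /tuple_prob [leLHS]big_mkcond [leRHS]big_mkcond; apply: ler_sum => h _.
rewrite big_tuple; case: ifP => [nuniq|_]; last first.
  by case: ifP => // _; apply: prodr_ge0 => i _.
case: ifP => // /asboolP; case.
apply: (@common_prefix_not_small_cancellation _ _ _ _ m.+1 n) => //.
- exact: leq_addr.
- by move=> w /mapP[x _ ->]; rewrite size_tuple.
- by rewrite -map_comp.
Qed.

End ConditionalLaw.

(** * Asymptotics at density [d] *)

Theorem proposition4p22 (R : realType) (A : finType) (A_nonempty : (0 < #|A|)%N)
    (X : markov_automaton R A)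
    (X_ergodic : ergodic X)
    (v : state X -> R) (v_stationary : stationary v)
    (X_nondegenerate : non_degenerate v)
    (X_no_cycle : ~ has_prob1_cycle X)
    (X_reduced : forall u : seq (letter A), init_word X u <> 0 -> reduced u)
    (lambda d : R)
    (lambda_range : 0 < lambda < 1 / 2)
    (d_range : lambda / 2 < d < 1) :
  (fun n : nat => tuple_prob X n (density_size X d n)
     [set h | ~ small_cancellation lambda h]) @ \oo --> (1 : R).
Proof.
have [q0 [a [p [init_q0 gam_q0 gam_p]]]] :=
  non_degenerate_witness v_stationary X_nondegenerate.
have init_q0_gt0 : 0 < init q0 by rewrite lt_def init_q0 init_ge0.
have gam_q0_gt0 : 0 < gam q0 a by rewrite lt_def gam_q0 gam_ge0.
case trans_q0 : (trans q0 a) => [q1|]; last first.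
  by rewrite (gam_trans_None trans_q0) eqxx in gam_q0.
have [c0 c0_gt0 [K0 _ last_ge]] := last_mass_lower_bound X_ergodic gam_p.
have [c1 c1_gt0 square_ge] := square_mass_ge q1 X_ergodic.
pose alpha := coincidence_prob X.
have alpha_gt0 : 0 < alpha := coincidence_prob_gt0 X.
have alpha_lt1 : alpha < 1 := coincidence_prob_lt1 X_no_cycle.
have [lambda_gt0 lambda_lt] := andP lambda_range.
have [d_gt d_lt] := andP d_range.
pose C := init q0 * gam q0 a * c0 * Num.sqrt c1.
have C_gt0 : 0 < C by rewrite !mulr_gt0 ?sqrtr_gt0.
(* Up to constants, the number of words times the square root of the collision bound is [z ^- n];
   [d > lambda / 2] gives [z < 1]. *)
pose z := alpha `^ (d - lambda / 2).
have pow_lt1 (e : R) : 0 < e -> 0 < alpha `^ e < 1.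
  move=> e_gt0; rewrite powR_gt0 //=.
  have := gt0_ltr_powR e_gt0 _ _ alpha_lt1; rewrite powR1; apply.
    by rewrite nnegrE ltW.
  by rewrite nnegrE.
have cvg_pow (e : R) : 0 < e -> (fun n : nat => (alpha `^ e) ^+ n) @ \oo --> (0 : R).
  by case/pow_lt1/andP => e0 e1; apply: cvg_expr; rewrite ger0_norm ?ltW.
have d_gt0 : 0 < d by lra.
apply: (@squeeze_cvgr _ _ _ _ (fun n => 1 - 4 / C * z ^+ n) (fun=> 1)); last 2 first.
- rewrite -[X in _ --> X]subr0 -(mulr0 (4 / C)); apply: cvgB; first exact: cvg_cst.
  by apply: cvgMl_tmp; apply: cvg_pow; lra.
- exact: cvg_cst.
near=> n.
(* Prefixes have length [m.+1], which exceeds [lambda * n], while the square mass is taken at length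
   [m <= lambda * n]. *)
pose m := Num.truncn (lambda * n%:R); pose k := (n - m.+1)%N.
pose x := alpha `^ (- (d * n%:R)).
have n_large : (2 * K0 + 4 <= n)%N by near: n; exact: nbhs_infty_ge.
have x_ge4 : 4 <= x.
  have : (alpha `^ d) ^+ n < 1 / 4.
    by near: n; apply: (cvgr_lt 0); [exact: cvg_pow|lra].
  rewrite -powR_mulrn ?powR_ge0 // -powRrM /x powRN => small.
  rewrite -[leLHS]invrK lef_pV2 ?posrE ?powR_gt0 //; lra.
have /truncn_itv/andP[m_le m_gt] : 0 <= lambda * n%:R by rewrite mulr_ge0 // ltW.
rewrite -/m in m_le m_gt.
(* As [lambda < 1 / 2], about half of the word remains after the prefix, which puts [k] beyond
   [K0]. *)
have m2_le : (m * 2 <= n)%N.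
  rewrite -(ler_nat R) natrM; apply: (@le_trans _ _ (lambda * n%:R * 2)).
    by rewrite ler_wpM2r.
  have : 0 <= n%:R :> R by [].
  nra.
have nE : n = (m.+1 + k)%N by rewrite /k; lia.
have k_gt0 : (0 < k)%N by rewrite /k; lia.
have k_large : (K0 <= k)%N by rewrite /k; lia.
have /truncn_itv/andP[N_le N_gt] : 0 <= x by apply: powR_ge0.
set N := density_size X d n.
rewrite -/(density_size X d n) -/N in N_le N_gt.
have N_gt1 : (1 < N)%N.
  by rewrite -ltnS -(ltr_nat R); apply: lt_trans N_gt; lra.
(* From [x < N + 1 <= 2 * N./2 + 2] and [4 <= x]; this is the source of the 4 in the squeeze. *)
have N2_ge : x / 4 <= N./2%:R.
  have : N.+1%:R <= (N./2 * 2 + 2)%:R :> R.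
    by rewrite ler_nat; have := odd_double_half N; lia.
  rewrite natrD natrM; lra.
pose s := C * alpha `^ (lambda * n%:R / 2).
have s_gt0 : 0 < s by rewrite mulr_gt0 ?powR_gt0.
have s_le : s ^+ 2 <= (init q0 * gam q0 a * c0) ^+ 2 * square_mass m q1.
  rewrite /s /C exprMn [in leLHS]exprMn -mulrA ler_pM2l; last first.
    by rewrite exprn_gt0 // !mulr_gt0.
  rewrite sqr_sqrtr; last exact: ltW.
  apply: le_trans (square_ge m).
  rewrite ler_pM2l // -(powR_mulrn 2 (powR_ge0 _ _)) -powRrM divfK ?pnatr_eq0 //.
  rewrite -/alpha -(powR_mulrn m (ltW alpha_gt0)); apply: ger_powR => //.
  by rewrite alpha_gt0 ltW.
have last_k := last_ge _ k_large.
have lambda_m : lambda * (m.+1 + k)%:R <= m.+1%:R by rewrite -nE ltW.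
have key := tuple_prob_not_small_cancellation_ge X_reduced init_q0_gt0 gam_q0_gt0
  trans_q0 c0_gt0 k_gt0 last_k lambda_m N_gt1 s_gt0 s_le.
have le1 := tuple_prob_le1 X_reduced m init_q0_gt0 gam_q0_gt0
  trans_q0 c0_gt0 k_gt0 last_k N [set h | ~ small_cancellation lambda h].
rewrite -nE in key le1; rewrite le1 andbT; apply: le_trans key.
rewrite lerD2l lerN2 -[leRHS]invrK lef_pV2 ?posrE ?invr_gt0 ?mulr_gt0
  ?invr_gt0 ?exprn_gt0 ?powR_gt0 ?ltr0n ?half_gt0 ?sqrtr_gt0 //.
have -> : (4 / C * z ^+ n)^-1 = x / 4 * s.
  have -> : z ^+ n = (x * alpha `^ (lambda * n%:R / 2))^-1.
    rewrite -powR_mulrn ?powR_ge0 // -powRrM -powRD; last first.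
      by apply/implyP => _; rewrite gt_eqF.
    by rewrite -powRN; congr (_ `^ _); field.
  by rewrite /s; field; rewrite !gt_eqF ?powR_gt0.
by rewrite ler_wpM2r // ltW.
Unshelve. all: by end_near.
Qed.
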